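(* Let $G$ be a finite group such that the undirected normalizing graph $\Gamma_{\rm norm}(G)$ is complete. Then: (i) $G$ is nilpotent of nilpotency class at most $3$; (ii) all involutions of $G$ commute with each other.
   Context: For a group $G$, the undirected normalizing graph $\Gamma_{\rm norm}(G)$ is the simple graph whose vertices are the elements of $G$, where two distinct elements $x,y$ are adjacent if and only if $\langle x\rangle$ is normal in $\langle x,y\rangle$ or $\langle y\rangle$ is normal in $\langle x,y\rangle$. Complete means that any two distinct vertices are adjacent. *)

(* Defs.v *)
From mathcomp Require Import all_boot all_fingroup all_solvable.

Set Implicit Arguments.
Unset Strict Implicit.
Unset Printing Implicit Defensive.

Local Open Scope group_scope.

Section NormalizingGraph.

Variable gT : finGroupType.

(* The subgroup <x, y> only depends on x and y, so the normalizing graph of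
   G : {group gT} is this relation restricted to the elements of G. *)
Definition norm_adj : rel gT := fun x y =>
  (x != y) && ((<[x]> <| <<[set x; y]>>) || (<[y]> <| <<[set x; y]>>)).

Lemma norm_adj_sym : symmetric norm_adj.
Proof. by move=> x y; rewrite /norm_adj eq_sym setUC orbC. Qed.

Lemma norm_adj_irr : irreflexive norm_adj.
Proof. by move=> x; rewrite /norm_adj eqxx. Qed.

End NormalizingGraph.

Definition complete_on (T : finType) (V : {set T}) (e : rel T) : Prop :=
  {in V &, forall x y, x != y -> e x y}.

(* Main.v *)
Require Import Defs.
From mathcomp Require Import all_boot all_fingroup all_solvable.

Set Implicit Arguments.
Unset Strict Implicit.
Unset Printing Implicit Defensive.

Local Open Scope group_scope.

(** Applying completeness to the pair [x * y], [y] as well as to [x], [y] shows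
    that [[~ x, y]] commutes with [x] and [y], so that [G] is a 2-Engel group.
    In a 2-Engel group [[~ x, y, z]] is alternating and, by the Hall-Witt
    identity, has trivial cube; hence [f = [~ x, y, z, t]] is alternating too and
    [f ^+ 3 = 1].  The even permutation exchanging [(x, y)] and [(z, t)] maps
    [f = [~ z, t, [~ x, y]]] to its inverse, so [f ^+ 2 = 1] and [f = 1]. *)

Section TwoEngel.

Variables (gT : finGroupType) (G : {group gT}).
Hypothesis engelG : {in G &, forall x y, commute y [~ x, y]}.

Lemma engel_commuteR : {in G &, forall x y, commute x [~ x, y]}.
Proof. by move=> x y Gx Gy; rewrite -invgR; apply/commuteV/engelG. Qed.

Lemma engel_commVg : {in G &, forall x y, [~ x^-1, y] = [~ x, y]^-1}.
Proof. by move=> x y Gx Gy; apply/commVg/engel_commuteR. Qed.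

Lemma engel_commgV : {in G &, forall x y, [~ x, y^-1] = [~ x, y]^-1}.
Proof. by move=> x y Gx Gy; apply/commgV/engelG. Qed.

Lemma engel_comm3_swap12 :
  {in G & &, forall x y z, [~ y, x, z] = [~ x, y, z]^-1}.
Proof.
by move=> x y z Gx Gy Gz; rewrite -(invgR x y) engel_commVg ?groupR.
Qed.

(* Linearization of [commute y [~ y, x]]: replace [y] by [y * z]. *)
Lemma engel_comm3_swap13 :
  {in G & &, forall y x z, [~ z, x, y] = [~ y, x, z]^-1}.
Proof.
move=> y x z Gy Gx Gz.
have := engel_commuteR (groupM Gy Gz) Gx; rewrite commMgJ.
have := engel_commuteR Gy Gx; have := engel_commuteR Gz Gx.
have Gp : [~ y, x] \in G by apply: groupR.
have Gq : [~ z, x] \in G by apply: groupR.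
move: [~ y, x] [~ z, x] Gp Gq => p q Gp Gq zq yp yz_pq.
(* [[~ y * z, x] = p ^ z * q] commutes with [y * z]; since [z] commutes with [q], it can be
   cancelled on the right. *)
have ypq : y * p * q = p ^ z * q * y.
  apply: (mulIg z); rewrite -[RHS]mulgA -yz_pq conjgE -!mulgA !mulKVg.
  by rewrite zq.
rewrite -(invgK [~ q, y]) invgR; congr (_^-1).
(* Inverting both entries leaves [[~ y, q]] unchanged, and [[~ y^-1, q^-1] * (q * y)] collapses to
   [y * q]. *)
rewrite -[LHS]invgK -(engel_commVg Gy Gq) -engel_commgV ?groupV //.
apply: (mulgI p); apply: (mulIg (q * y)).
rewrite !commgEl mulKVg {1}/conjg !invgK !mulgA !mulgKV.
by rewrite -ypq yp.
Qed.

Lemma engel_comm3_swap23 :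
  {in G & &, forall x y z, [~ x, z, y] = [~ x, y, z]^-1}.
Proof.
move=> x y z Gx Gy Gz.
by rewrite engel_comm3_swap12 // engel_comm3_swap13 // engel_comm3_swap12 ?invgK.
Qed.

Lemma engel_comm3_rot :
  {in G & &, forall x y z, [~ y, z, x] = [~ x, y, z]}.
Proof.
move=> x y z Gx Gy Gz.
by rewrite engel_comm3_swap23 // engel_comm3_swap12 // invgK.
Qed.

Lemma engel_comm3_cube : {in G & &, forall x y z, [~ x, y, z] ^+ 3 = 1}.
Proof.
move=> x y z Gx Gy Gz; have := Hall_Witt_identity x y z.
have conjV a b c : a \in G -> b \in G -> c \in G ->
  [~ a, b^-1, c] ^ b = [~ a, b, c]^-1.
  move=> Ga Gb Gc; rewrite engel_commgV // engel_commVg ?groupR //.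
  (* Rotation brings [b] to the last place, where the Engel condition applies; so conjugation by [b]
     is trivial and the three Hall-Witt factors coincide. *)
  have: commute b [~ a, b, c].
    rewrite -(engel_comm3_rot Ga Gb Gc) -(engel_comm3_rot Gb Gc Ga).
    by apply: engelG; rewrite ?groupR.
  by move=> cb; apply/conjg_fixP/commgP/commute_sym/commuteV.
rewrite !conjV // (engel_comm3_rot Gy Gz Gx) (engel_comm3_rot Gx Gy Gz).
by move/eqP; rewrite -!invMg invg_eq1 => /eqP.
Qed.

Lemma engel_comm4 : {in G & &, forall x y z, {in G, forall t, [~ x, y, z, t] = 1}}.
Proof.
move=> x y z Gx Gy Gz t Gt; set f := [~ _, _, _, _].
have Gxy : [~ x, y] \in G by apply: groupR.
have Gzt : [~ z, t] \in G by apply: groupR.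
have f3 : f ^+ 3 = 1.
  rewrite /f -commXg; first by rewrite engel_comm3_cube // comm1g.
  by apply: engel_commuteR; rewrite ?groupR.
(* With [[~ x, y]] taken as a single entry, [f] is a triple commutator and can be rotated. *)
have fE : f = [~ z, t, [~ x, y]] by rewrite engel_comm3_rot.
have fE' : f^-1 = [~ z, t, x, y].
  by rewrite -(engel_comm3_rot Gzt Gx Gy) fE invgR.
have fE'' : f = [~ z, t, x, y].
  (* A 3-cycle, then two transpositions whose signs cancel. *)
  rewrite (engel_comm3_rot Gx Gz Gt) (engel_comm3_swap23 (groupR Gx Gz) Gy Gt).
  rewrite (engel_comm3_swap23 Gx Gy Gz) engel_commVg ?groupR //.
  by rewrite invgK.
have f2 : f ^+ 2 = 1 by rewrite expgS expg1 {1}fE'' -fE' mulVg.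
by move: f3; rewrite expgS f2 mulg1.
Qed.

Lemma ucnS_comm n x : x \in G -> {in G, forall y, [~ x, y] \in 'Z_n(G)} ->
  x \in 'Z_n.+1(G).
Proof.
move=> Gx Zxy; rewrite ucnSnR inE Gx gen_subG.
by apply/subsetP=> _ /imset2P[_ y /set1P-> Gy ->]; apply: Zxy.
Qed.

Lemma engel_nil_class : nilpotent G /\ nil_class G <= 3.
Proof.
have Z3 : 'Z_3(G) = G.
  apply/eqP; rewrite eqEsubset ucn_sub; apply/subsetP=> x Gx.
  apply: ucnS_comm => // y Gy; apply: ucnS_comm => [|z Gz]; first exact: groupR.
  apply: ucnS_comm => [|t Gt]; first by rewrite !groupR.
  by rewrite engel_comm4 // group1.
have nilG : nilpotent G by rewrite -Z3 ucn_nilpotent.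
by split=> //; apply/(ucn_nil_classP _ nilG).
Qed.

End TwoEngel.

(** Since [<[x]>] is [{1, x}], the only other value of [[~ x, y]] is [x], which forces [x ^ y = 1]
    and so [x = 1]. *)
Lemma involution_commute (gT : finGroupType) (x y : gT) :
  #[x] = 2%N -> [~ x, y] \in <[x]> -> commute x y.
Proof.
move=> ox; rewrite cycle2g // !inE => /orP[/commgP//|].
have xV : x^-1 = x by apply/eqP; rewrite eq_invg_mul -[_ * _]/(x ^+ 2) -ox expg_order.
rewrite commgEl xV -{3}[x]mulg1 (inj_eq (mulgI x)).
by rewrite conjg_eq1 => /eqP->; apply/commute_sym/commute1.
Qed.

Section CompleteNormalizingGraph.

Variables (gT : finGroupType) (G : {group gT}).
Hypothesis complG : complete_on G (@norm_adj gT).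

(** If [x] normalizes [<[y]>], then [[~ x, y]] is a product of [y] and a conjugate of [y^-1] by [x];
    likewise with the roles exchanged. *)
Lemma complete_comm_cycle :
  {in G &, forall x y, ([~ x, y] \in <[x]>) || ([~ x, y] \in <[y]>)}.
Proof.
move=> x y Gx Gy; have [->|neq_xy] := eqVneq x y; first by rewrite commgg group1.
have /andP[_ /orP[] /andP[_]] := complG Gx Gy neq_xy; rewrite gen_subG subUset !sub1set.
  by case/andP=> _ Ny; apply/orP; left; rewrite commgEl groupM ?groupV ?memJ_norm ?cycle_id.
by case/andP=> Nx _; apply/orP; right; rewrite commgEr groupM ?memJ_norm ?groupV ?cycle_id.
Qed.

Lemma complete_engel : {in G &, forall x y, commute y [~ x, y]}.
Proof.
move=> x y Gx Gy.
have cyc (a b : gT) : b \in <[a]> -> commute a b.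
  by move=> /cycleP[n ->]; apply/commuteX.
have /orP[/cyc cx|/cyc//] := complete_comm_cycle Gx Gy.
(* In the remaining case [[~ x, y]] commutes with [x]. Its conjugate by [y] commutes with [x * y] or
   with [y]; undoing the conjugation, [[~ x, y]] commutes with [y * x] or with [y]. *)
have xyE : [~ x * y, y] = [~ x, y] ^ y by rewrite commMgJ commgg mulg1.
have /orP[] := complete_comm_cycle (groupM Gx Gy) Gy; rewrite xyE => /cyc cxy.
  have xyJ : (y * x) ^ y = x * y by rewrite conjgE -mulgA mulKg.
  have {}cxy : commute (y * x) [~ x, y].
    by apply: (conjg_inj y); rewrite !(conjMg _ [~ x, y]) (conjMg [~ x, y]) xyJ.
  move: [~ x, y] cx cxy {xyE} => c cx cxy.
  by apply: (mulIg x); rewrite -[RHS]mulgA -cxy -!mulgA cx.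
have yJ : y ^ y = y by rewrite conjgE mulKg.
by apply: (conjg_inj y); rewrite (conjMg y) (conjMg [~ x, y]) yJ.
Qed.

End CompleteNormalizingGraph.

Theorem theorem4p3 (gT : finGroupType) (G : {group gT})
    (complG : complete_on G (@norm_adj gT)) :
  (nilpotent G /\ (nil_class G <= 3)%N) /\
  {in G &, forall x y, #[x] = 2%N -> #[y] = 2%N -> commute x y}.
Proof.
split; first exact/engel_nil_class/complete_engel.
move=> x y Gx Gy ox oy.
have /orP[|] := complete_comm_cycle complG Gx Gy; first exact: involution_commute.
(* The inverse [[~ y, x]] also lies in [<[y]>]. *)
rewrite -groupV invgR => /(involution_commute oy); exact: commute_sym.
Qed.
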